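(* Let $n\ge2$. Let $A_1=\{2\text{-}13,21\text{-}3\}$, $A_2=\{2\text{-}31,23\text{-}1\}$, $A_3=\{1\text{-}32,13\text{-}2\}$, $A_4=\{3\text{-}12,31\text{-}2\}$. For every choice of $p_i\in A_i$ ($i=1,2,3,4$), $|S_n(p_1,p_2,p_3,p_4)|=2$ and $$S_n(p_1,p_2,p_3,p_4)=\{\,n\,(n-1)\ldots 2\,1,\ \ 1\,2\ldots n\,\}.$$
   Context: $S_n$ is the set of permutations $\pi=\pi_1\pi_2\cdots\pi_n$ of $\{1,\dots,n\}$ (written in one-line notation). For $abc$ a permutation of $123$, the generalized pattern $a\text{-}bc$ is contained in $\pi$ if there are indices $i<j$ with $j+1\le n$ such that $\pi_i\pi_j\pi_{j+1}$ is order-isomorphic to $abc$; the generalized pattern $ab\text{-}c$ is contained in $\pi$ if there are indices $i,k$ with $i+1<k\le n$ such that $\pi_i\pi_{i+1}\pi_k$ is order-isomorphic to $abc$. $\pi$ avoids a pattern if it does not contain it. $S_n(p_1,\dots,p_m)$ is the set of $\pi\in S_n$ avoiding all of $p_1,\dots,p_m$. *)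

(* Defs.v *)
From HB Require Import structures.
From mathcomp Require Import all_boot all_fingroup.

Set Implicit Arguments.
Unset Strict Implicit.
Unset Printing Implicit Defensive.

(* A permutation of {1, .., n} is modelled by pi : {perm 'I_n}, i.e. positions
   and values are shifted down by one; its one-line notation is recovered by
   [oneline].  The shift does not affect order isomorphism. *)
Definition oneline (n : nat) (pi : {perm 'I_n}) : seq nat :=
  [seq (pi i).+1 | i <- enum 'I_n].

Definition order_isomorphic (s t : seq nat) : Prop :=
  size s = size t /\
  forall i j : nat, i < size s -> j < size s ->
    (nth 0 s i < nth 0 s j) = (nth 0 t i < nth 0 t j).

(* [pat_a_bc a b c] is a-bc, [pat_ab_c a b c] is ab-c. *)
Inductive gpattern : Type :=
| pat_a_bc of nat & nat & nat
| pat_ab_c of nat & nat & nat.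

Definition gpattern_code (p : gpattern) : bool * (nat * nat * nat) :=
  match p with
  | pat_a_bc a b c => (false, (a, b, c))
  | pat_ab_c a b c => (true, (a, b, c))
  end.

Definition gpattern_decode (u : bool * (nat * nat * nat)) : gpattern :=
  let: (d, (a, b, c)) := u in if d then pat_ab_c a b c else pat_a_bc a b c.

Lemma gpattern_codeK : cancel gpattern_code gpattern_decode.
Proof. by case. Qed.

HB.instance Definition _ := Equality.copy gpattern (can_type gpattern_codeK).

Definition contains (n : nat) (pi : {perm 'I_n}) (p : gpattern) : Prop :=
  match p with
  | pat_a_bc a b c => exists i j j' : 'I_n,
      [/\ i < j, j' = j.+1 :> nat
        & order_isomorphic [:: val (pi i); val (pi j); val (pi j')] [:: a; b; c]]
  | pat_ab_c a b c => exists i i' k : 'I_n,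
      [/\ i' = i.+1 :> nat, i' < k
        & order_isomorphic [:: val (pi i); val (pi i'); val (pi k)] [:: a; b; c]]
  end.

Definition avoids (n : nat) (pi : {perm 'I_n}) (p : gpattern) : Prop :=
  ~ contains pi p.

(* {set _} needs boolean membership, hence boolean versions of the above. *)
Definition order_isomorphicb (s t : seq nat) : bool :=
  (size s == size t) &&
  [forall i : 'I_(size s), forall j : 'I_(size s),
    (nth 0 s i < nth 0 s j) == (nth 0 t i < nth 0 t j)].

Lemma order_isomorphicP (s t : seq nat) :
  reflect (order_isomorphic s t) (order_isomorphicb s t).
Proof.
apply: (iffP andP) => [[/eqP sz /forallP H]|[sz H]]; split=> //.
- move=> i j Hi Hj.
  by have /forallP/(_ (Ordinal Hj))/eqP := H (Ordinal Hi).
- by apply/eqP.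
- by apply/forallP=> i; apply/forallP=> j; apply/eqP; apply: H.
Qed.

Definition containsb (n : nat) (pi : {perm 'I_n}) (p : gpattern) : bool :=
  match p with
  | pat_a_bc a b c => [exists i : 'I_n, exists j : 'I_n, exists j' : 'I_n,
      [&& i < j, val j' == j.+1
        & order_isomorphicb [:: val (pi i); val (pi j); val (pi j')] [:: a; b; c]]]
  | pat_ab_c a b c => [exists i : 'I_n, exists i' : 'I_n, exists k : 'I_n,
      [&& val i' == i.+1, i' < k
        & order_isomorphicb [:: val (pi i); val (pi i'); val (pi k)] [:: a; b; c]]]
  end.

Lemma containsP (n : nat) (pi : {perm 'I_n}) (p : gpattern) :
  reflect (contains pi p) (containsb pi p).
Proof.
case: p => a b c; apply: (iffP existsP) => [[i]|[i [j [k []]]]].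
- case/existsP=> j /existsP[k] /and3P[H1 /eqP H2 /order_isomorphicP H3].
  by exists i, j, k.
- move=> H1 H2 H3; exists i; apply/existsP; exists j; apply/existsP; exists k.
  by apply/and3P; split=> //; [apply/eqP | apply/order_isomorphicP].
- case/existsP=> j /existsP[k] /and3P[/eqP H1 H2 /order_isomorphicP H3].
  by exists i, j, k.
- move=> H1 H2 H3; exists i; apply/existsP; exists j; apply/existsP; exists k.
  by apply/and3P; split=> //; [apply/eqP | apply/order_isomorphicP].
Qed.

(* S_n(p_1, .., p_m) *)
Definition avoiders (n : nat) (ps : seq gpattern) : {set {perm 'I_n}} :=
  [set pi : {perm 'I_n} | all (fun p => ~~ containsb pi p) ps].

Lemma avoidersP (n : nat) (ps : seq gpattern) (pi : {perm 'I_n}) :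
  reflect (forall p, p \in ps -> avoids pi p) (pi \in avoiders n ps).
Proof.
rewrite inE; apply: (iffP allP) => H p /H; first by move/containsP.
by move=> Hp; apply/containsP.
Qed.

Definition incr_perm (n : nat) : {perm 'I_n} := 1%g.

Definition decr_perm (n : nat) : {perm 'I_n} := perm (@rev_ord_inj n).

Lemma oneline_incr (n : nat) : oneline (incr_perm n) = iota 1 n.
Proof.
rewrite /oneline (eq_map (g := succn \o val)); last by move=> i; rewrite /= perm1.
by rewrite map_comp val_enum_ord -[1]addn0 iotaDl.
Qed.

Lemma oneline_decr (n : nat) : oneline (decr_perm n) = rev (iota 1 n).
Proof.
rewrite /oneline (eq_map (g := (fun m => n - m) \o val)); last first.
  by move=> i; rewrite /= permE /= subnSK.
rewrite map_comp val_enum_ord.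
apply: (@eq_from_nth _ 0); rewrite ?size_map ?size_rev ?size_iota // => i Hi.
rewrite (nth_map 0) ?size_iota // nth_rev ?size_iota // !nth_iota ?add0n //.
  by rewrite add1n subnSK.
by rewrite ltn_subrL (leq_ltn_trans _ Hi).
Qed.

(* Main.v *)
(* Three consecutive positions witness an occurrence of a-bc as well as of ab-c.
   Hence, whatever the choices, an avoider has no three consecutive letters
   forming a peak or a valley (213, 231, 132, 312), so it is monotone.
   Conversely an occurrence of any of these patterns in a monotone permutation
   would be a non-monotone subsequence of length three. *)
Require Import Defs.
From mathcomp Require Import all_boot all_fingroup.

Lemma size_oneline (n : nat) (pi : {perm 'I_n}) : size (oneline pi) = n.
Proof. by rewrite size_map size_enum_ord. Qed.

Lemma nth_oneline (n : nat) (pi : {perm 'I_n}) (i : 'I_n) :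
  nth 0 (oneline pi) i = (pi i).+1.
Proof. by rewrite (nth_map i) ?size_enum_ord // nth_ord_enum. Qed.

Lemma oneline_inj (n : nat) : injective (@oneline n).
Proof.
move=> pi tau eq_pt; apply/permP=> i; apply: val_inj; apply: succn_inj.
by rewrite -!nth_oneline eq_pt.
Qed.

(** The word has $n$ distinct letters, all in $\{1,\dots,n\}$, so by counting it uses every one of
    them. *)
Lemma mem_oneline (n : nat) (pi : {perm 'I_n}) : oneline pi =i iota 1 n.
Proof.
apply: (uniq_min_size _ _ _).2; last by rewrite size_oneline size_iota.
  by rewrite map_inj_uniq ?enum_uniq // => i j /succn_inj/val_inj/perm_inj.
by move=> _ /mapP[i _ ->]; rewrite mem_iota add1n !ltnS ltn_ord.
Qed.

(** A strictly sorted word is determined by its set of letters, and all permutations of the same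
    size share that set. *)
Lemma oneline_sorted_ltn (n : nat) (pi : {perm 'I_n}) :
  sorted ltn (oneline pi) -> pi = incr_perm n.
Proof.
move=> incr_pi; apply: oneline_inj; rewrite oneline_incr.
apply: (irr_sorted_eq ltn_trans ltnn incr_pi) (mem_oneline _ pi).
exact: iota_ltn_sorted.
Qed.

Lemma oneline_sorted_gtn (n : nat) (pi : {perm 'I_n}) :
  sorted gtn (oneline pi) -> pi = decr_perm n.
Proof.
move=> decr_pi; apply: oneline_inj; rewrite oneline_decr.
have gtn_trans : transitive gtn by move=> y x z /= yx zy; apply: ltn_trans yx.
apply: (irr_sorted_eq gtn_trans ltnn decr_pi).
  by rewrite rev_sorted; apply: iota_ltn_sorted.
by move=> x; rewrite mem_rev mem_oneline.
Qed.

Lemma contains_consecutive (n : nat) (pi : {perm 'I_n}) (a b c : nat)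
    (p : gpattern) (i j k : 'I_n) :
  p \in [:: pat_a_bc a b c; pat_ab_c a b c] ->
  j = i.+1 :> nat -> k = j.+1 :> nat ->
  order_isomorphic [:: val (pi i); val (pi j); val (pi k)] [:: a; b; c] ->
  contains pi p.
Proof.
rewrite !inE => /orP[] /eqP-> ij jk iso.
  by exists i, j, k; split=> //; rewrite ij.
by exists i, j, k; split=> //; rewrite jk.
Qed.

Lemma contains_subsequence (n : nat) (pi : {perm 'I_n}) (a b c : nat)
    (p : gpattern) :
  p \in [:: pat_a_bc a b c; pat_ab_c a b c] -> contains pi p ->
  exists i j k : 'I_n, [/\ i < j, j < k &
    order_isomorphic [:: val (pi i); val (pi j); val (pi k)] [:: a; b; c]].
Proof.
rewrite !inE => /orP[]/eqP-> [i [j [k [ij jk iso]]]]; exists i, j, k.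
  by split=> //; rewrite jk.
by split=> //; rewrite ij.
Qed.

(** Three comparisons suffice: distinctness makes each reversed comparison the negation of the
    direct one ([flip]), and the diagonal ones are false on both sides. *)
Lemma order_isomorphic_3 (x y z a b c : nat) :
  x != y -> y != z -> x != z -> a != b -> b != c -> a != c ->
  (x < y) = (a < b) -> (y < z) = (b < c) -> (x < z) = (a < c) ->
  order_isomorphic [:: x; y; z] [:: a; b; c].
Proof.
move=> xy yz xz ab bc ac exy eyz exz; split=> //.
have flip u v : u != v -> (v < u) = ~~ (u < v).
  by rewrite -leqNgt => uv; rewrite ltn_neqAle eq_sym uv.
by case=> [|[|[|?]]] [|[|[|?]]] //= _ _; rewrite ?ltnn //
  ?(flip x y, flip y z, flip x z) ?(flip a b, flip b c, flip a c) ?exy ?eyz ?exz.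
Qed.

(** The boolean [u] treats increasing ([true]) and decreasing ([false]) permutations at once. An
    occurrence would give both [a < b] and [b < c] the value [u], whereas the middle letter of [abc]
    is a peak or a valley. *)
Lemma monotone_avoids (n : nat) (pi : {perm 'I_n}) (u : bool) (a b c : nat)
    (p : gpattern) :
  (forall i j : 'I_n, i < j -> (pi i < pi j) = u) ->
  p \in [:: pat_a_bc a b c; pat_ab_c a b c] -> (a < b) != (b < c) ->
  avoids pi p.
Proof.
move=> mono_pi p_abc /eqP abc.
case/(contains_subsequence _ pi a b c p p_abc) => i [j [k [ij jk [_ iso]]]].
apply: abc; move: (iso 0 1 isT isT) (iso 1 2 isT isT) => /= <- <-.
by rewrite !mono_pi.
Qed.

Lemma ltn_decr_perm (n : nat) (i j : 'I_n) :
  i < j -> (decr_perm n i < decr_perm n j) = false.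
Proof. by move=> ij; rewrite !permE /= ltnNge leq_sub2l // ltnW. Qed.

Theorem proposition2p7 (n : nat) (hn : 2 <= n) (p1 p2 p3 p4 : gpattern)
  (hp1 : p1 \in [:: pat_a_bc 2 1 3; pat_ab_c 2 1 3])
  (hp2 : p2 \in [:: pat_a_bc 2 3 1; pat_ab_c 2 3 1])
  (hp3 : p3 \in [:: pat_a_bc 1 3 2; pat_ab_c 1 3 2])
  (hp4 : p4 \in [:: pat_a_bc 3 1 2; pat_ab_c 3 1 2]) :
  #|avoiders n [:: p1; p2; p3; p4]| = 2 /\
  avoiders n [:: p1; p2; p3; p4] = [set decr_perm n; incr_perm n].
Proof.
have -> : avoiders n [:: p1; p2; p3; p4] = [set decr_perm n; incr_perm n].
  apply/setP=> pi; rewrite !inE.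
  have mono_in u : (forall i j : 'I_n, i < j -> (pi i < pi j) = u) ->
      pi \in avoiders n [:: p1; p2; p3; p4].
    move=> mono_pi; apply/avoidersP=> p.
    rewrite !inE => /or4P[]/eqP->;
      [move: hp1 | move: hp2 | move: hp3 | move: hp4] => hp;
      exact: (monotone_avoids _ _ _ _ _ _ _ mono_pi hp).
  apply/idP/idP; last first.
    case/orP=> /eqP def_pi.
      have := mono_in false; rewrite inE; apply.
      by rewrite def_pi; apply: ltn_decr_perm.
    have := mono_in true; rewrite inE; apply.
    by rewrite def_pi => i j ij; rewrite !perm1.
  move=> avoid_pi; have {avoid_pi}/avoidersP avoid_pi :
    pi \in avoiders n [:: p1; p2; p3; p4] by rewrite inE.
  have neq_pi (i j : 'I_n) : i < j -> val (pi i) != val (pi j).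
    move=> ij; rewrite (inj_eq val_inj) (inj_eq perm_inj).
    by rewrite -(inj_eq val_inj) ltn_eqF.
  have step (i j k : 'I_n) : j = i.+1 :> nat -> k = j.+1 :> nat ->
      (pi i < pi j) = (pi j < pi k).
    move=> ij jk.
    have lt_ij : i < j by rewrite ij.
    have lt_jk : j < k by rewrite jk.
    have xy := neq_pi _ _ lt_ij; have yz := neq_pi _ _ lt_jk.
    have xz := neq_pi _ _ (ltn_trans lt_ij lt_jk).
    have absurd_iso a b c p : p \in [:: p1; p2; p3; p4] ->
        p \in [:: pat_a_bc a b c; pat_ab_c a b c] ->
        a != b -> b != c -> a != c ->
        (pi i < pi j) = (a < b) -> (pi j < pi k) = (b < c) ->
        (pi i < pi k) = (a < c) -> false.
      move=> /avoid_pi no_p hp ab bc ac e1 e2 e3; case: no_p.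
      by apply: contains_consecutive hp ij jk _; apply: order_isomorphic_3.
    have m1 : p1 \in [:: p1; p2; p3; p4] by rewrite !inE eqxx.
    have m2 : p2 \in [:: p1; p2; p3; p4] by rewrite !inE eqxx !orbT.
    have m3 : p3 \in [:: p1; p2; p3; p4] by rewrite !inE eqxx !orbT.
    have m4 : p4 \in [:: p1; p2; p3; p4] by rewrite !inE eqxx !orbT.
    (* Only peaks and valleys remain. Comparing the outer letters splits peaks into 132 and 231, and
       valleys into 213 and 312, each excluded by one of the four patterns. *)
    case e1: (pi i < pi j); case e2: (pi j < pi k) => //;
      case e3: (pi i < pi k).
    - by have := absurd_iso _ _ _ _ m3 hp3 isT isT isT e1 e2 e3.
    - by have := absurd_iso _ _ _ _ m2 hp2 isT isT isT e1 e2 e3.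
    - by have := absurd_iso _ _ _ _ m1 hp1 isT isT isT e1 e2 e3.
    - by have := absurd_iso _ _ _ _ m4 hp4 isT isT isT e1 e2 e3.
  pose s := oneline pi.
  have nth_s k (lt_kn : k < n) : nth 0 s k = (pi (Ordinal lt_kn)).+1.
    by rewrite -nth_oneline.
  (* Every adjacent comparison agrees with the first one, which therefore decides the direction of
     the whole word. *)
  have steps k : k.+1 < n ->
      (nth 0 s k < nth 0 s k.+1) = (nth 0 s 0 < nth 0 s 1).
    elim: k => // k IHk lt_k2n.
    have lt_k1n := ltnW lt_k2n; have lt_kn := ltnW lt_k1n.
    rewrite -(IHk lt_k1n) (nth_s _ lt_kn) (nth_s _ lt_k1n) (nth_s _ lt_k2n).
    by rewrite !ltnS; apply: esym; apply: step.
  apply/orP; case up: (nth 0 s 0 < nth 0 s 1); [right | left]; apply/eqP.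
    apply: oneline_sorted_ltn; apply/(sortedP 0) => k.
    by rewrite size_oneline => lt_k1n; rewrite /= steps.
  apply: oneline_sorted_gtn; apply/(sortedP 0) => k.
  rewrite size_oneline => lt_k1n; have := steps k lt_k1n.
  (* The negated comparison only gives a weak descent; equality of adjacent letters is excluded by
     injectivity. *)
  rewrite up => /negbT; rewrite -leqNgt /= leq_eqVlt => /orP[|//].
  have lt_kn := ltnW lt_k1n.
  by rewrite (nth_s _ lt_kn) (nth_s _ lt_k1n) eqSS eq_sym (negbTE (neq_pi _ _ _)).
split=> //; rewrite cards2.
(* If the two permutations coincided, their values $n-1$ and $0$ at position 0 would be equal,
   contradicting $n\ge2$. *)
case: eqP => // /permP/(_ (Ordinal (ltnW hn)))/(congr1 val).
by rewrite !permE /= => /eqP; rewrite subn_eq0 leqNgt hn.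
Qed.
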